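(* Let $\mathfrak{A}$ be a complete atomic weakly associative relation algebra, let $\mathfrak{B}=\langle B,T_\kappa,E_{\kappa\lambda}\rangle_{\kappa,\lambda<3}$ be its suitable structure, for every $t\in B$ let $R_t=\{\langle(p0)^{\mathfrak{B}},(p1)^{\mathfrak{B}},(p2)^{\mathfrak{B}}\rangle:p\in\mathrm{Tr}(\mathfrak{B}),\ p\text{ ends at }t\}$, and let $\mathfrak{C}$ be the subalgebra of the full 3-dimensional cylindric set algebra on $U(\mathfrak{B})$ completely generated by $\{R_t:t\in B\}$. Then $\mathfrak{A}\cong\mathfrak{Ra}\,\mathfrak{Rl}_{V(\mathfrak{B})}(\mathfrak{C})$, and $\{R_t:t\in B\}$ is the set of atoms of $\mathfrak{Rl}_{V(\mathfrak{B})}(\mathfrak{C})$.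
   Context: WA: algebras $\langle A,+,\overline{\phantom{x}},;,\breve{\phantom{x}},1'\rangle$ with $x\cdot y=\overline{\overline{x}+\overline{y}}$, $0'=\overline{1'}$, $1=1'+0'$, $0=\overline{1}$, satisfying for all $x,y,z$: $x+y=y+x$; $x+(y+z)=(x+y)+z$; $\overline{\overline{x}+\overline{y}}+\overline{\overline{x}+y}=x$; $((x\cdot 1');1);1=(x\cdot1');1$; $(x+y);z=x;z+y;z$; $x;1'=x$; $\breve{\breve{x}}=x$; $\breve{(x+y)}=\breve{x}+\breve{y}$; $\breve{(x;y)}=\breve{y};\breve{x}$; $\breve{x};\overline{x;y}+\overline{y}=\overline{y}$. $\mathrm{At}(\mathfrak{A})$ = atoms. Suitable structure: $B=\{s\in{}^3\mathrm{At}(\mathfrak{A}): s_2;s_0\ge s_1\}$; $T_\kappa=\{\langle s,t\rangle\in B\times B:s_\kappa=t_\kappa\}$; $E_{\kappa\kappa}=B$; for distinct $\kappa,\lambda$ with third index $\mu$, $E_{\kappa\lambda}=\{s\in B:s_\mu\le1'\}$. Trails: a $\mathfrak{B}$-trail is $p=\langle t_0,\kappa_0,\dots,t_n,\kappa_n\rangle$, $n\in\omega$, $t_i\in B$, $\kappa_i<3$, with $t_i\ne t_{i+1}$ and $\langle t_i,t_{i+1}\rangle\in T_{\kappa_i}$ for $i<n$; it ends at $t_n$. $\mathrm{Tr}(\mathfrak{B})$ = set of trails; $p\lambda=\langle t_0,\kappa_0,\dots,t_n,\lambda\rangle$. $\approx$ is the smallest equivalence relation on $\mathrm{Tr}(\mathfrak{B})$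 with (for trails of the displayed forms): (a) $\langle t_0,\kappa_0,\dots,t_i,\lambda,s,\lambda,t_i,\kappa_i,\dots,t_n,\kappa_n\rangle\approx\langle t_0,\kappa_0,\dots,t_i,\kappa_i,\dots,t_n,\kappa_n\rangle$; (b) $\langle t_0,\kappa_0,\dots,t_n,\lambda,s,\nu\rangle\approx\langle t_0,\kappa_0,\dots,t_n,\nu\rangle$ if $\lambda\ne\nu$; (c) $\langle t_0,\kappa_0,\dots,t_n,\lambda\rangle\approx\langle t_0,\kappa_0,\dots,t_n,\kappa_n\rangle$ if $t_n\in E_{\lambda\kappa_n}$. $p^{\mathfrak{B}}$ = $\approx$-class; $U(\mathfrak{B})=\{p^{\mathfrak{B}}:p\in\mathrm{Tr}(\mathfrak{B})\}$; $V(\mathfrak{B})=\bigcup_{t\in B}R_t$. The full cylindric set algebra on $U$: $\langle\mathcal{P}({}^3U),\cup,{}^3U\setminus\cdot,C_\kappa,D_{\kappa\lambda}\rangle_{\kappa,\lambda<3}$, $C_\kappa X=\{v\in{}^3U:\exists u\in X\ \forall\lambda\ne\kappa\ u_\lambda=v_\lambda\}$, $D_{\kappa\lambda}=\{v:v_\kappa=v_\lambda\}$; ''completely generated'' means the smallest subalgebra closed also under arbitrary unions. $\mathfrak{Rl}_V(\mathfrak{C})$: universe $\{X\in C:X\subseteq V\}$, operations $\cup$, $V\setminus\cdot$, $C^{[V]}_\kappa X=V\cap C_\kappa X$, constants $D^{[V]}_{\kappa\lambda}=V\cap D_{\kappa\lambda}$. Relation-algebraic reduct: for $\mathfrak{D}=\langle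 D,+,\overline{\phantom{x}},c_\kappa,d_{\kappa\lambda}\rangle_{\kappa,\lambda<3}$, $Nr_2\mathfrak{D}=\{x:c_2x=x\}$, $x;y=c_2(c_1(d_{12}\cdot x)\cdot c_0(d_{02}\cdot y))$, $\breve{x}=c_2(d_{20}\cdot c_0(d_{01}\cdot c_1(d_{12}\cdot x)))$, $\mathfrak{Ra}\,\mathfrak{D}=\langle Nr_2\mathfrak{D},+,\overline{\phantom{x}},;,\breve{\phantom{x}},d_{01}\rangle$. *)

(* Defs.v *)
From Stdlib Require Import List Relations.
Import ListNotations.

Inductive I3 := I0 | I1 | I2.

(** the third index mu for distinct kappa, lambda (value irrelevant when equal) *)
Definition third (k l : I3) : I3 :=
  match k, l with
  | I0, I1 | I1, I0 => I2
  | I0, I2 | I2, I0 => I1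
  | I1, I2 | I2, I1 => I0
  | _, _ => k
  end.

Definition get {T : Type} (s : T * T * T) (k : I3) : T :=
  match k with
  | I0 => fst (fst s)
  | I1 => snd (fst s)
  | I2 => snd s
  end.

Record WAsig := {
  car : Type;
  wplus : car -> car -> car;
  wcompl : car -> car;
  wcomp : car -> car -> car;
  wconv : car -> car;
  wid : car }.

Section Construction.
Variable A : WAsig.

Local Notation "x + y" := (wplus A x y).
Local Notation "- x" := (wcompl A x).

Definition wmeet (x y : car A) : car A := - (- x + - y).
Definition wdiv : car A := - (wid A).
Definition wtop : car A := wid A + wdiv.
Definition wbot : car A := - wtop.

Definition is_WA : Prop :=
  (forall x y, x + y = y + x) /\
  (forall x y z, x + (y + z) = (x + y) + z) /\
  (forall x y, - (- x + - y) + - (- x + y) = x) /\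
  (forall x, wcomp A (wcomp A (wmeet x (wid A)) wtop) wtop = wcomp A (wmeet x (wid A)) wtop) /\
  (forall x y z, wcomp A (x + y) z = wcomp A x z + wcomp A y z) /\
  (forall x, wcomp A x (wid A) = x) /\
  (forall x, wconv A (wconv A x) = x) /\
  (forall x y, wconv A (x + y) = wconv A x + wconv A y) /\
  (forall x y, wconv A (wcomp A x y) = wcomp A (wconv A y) (wconv A x)) /\
  (forall x y, wcomp A (wconv A x) (- (wcomp A x y)) + - y = - y).

Definition wle (x y : car A) : Prop := x + y = y.

Definition is_atom (x : car A) : Prop :=
  x <> wbot /\ forall y, wle y x -> y = wbot \/ y = x.

Definition is_complete : Prop :=
  forall S : car A -> Prop, exists s,
    (forall x, S x -> wle x s) /\
    (forall u, (forall x, S x -> wle x u) -> wle s u).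

Definition is_atomic : Prop :=
  forall x, x <> wbot -> exists a, is_atom a /\ wle a x.

Definition Tri : Type := (car A * car A * car A)%type.

Definition inB (s : Tri) : Prop :=
  is_atom (get s I0) /\ is_atom (get s I1) /\ is_atom (get s I2) /\
  wle (get s I1) (wcomp A (get s I2) (get s I0)).

Definition inT (k : I3) (s t : Tri) : Prop :=
  inB s /\ inB t /\ get s k = get t k.

Definition inE (k l : I3) (s : Tri) : Prop :=
  inB s /\ (k = l \/ (k <> l /\ wle (get s (third k l)) (wid A))).

(** Trails: <t0,k0,...,tn,kn> as the nonempty list [(t0,k0);...;(tn,kn)] *)
Definition Node : Type := (Tri * I3)%type.

Fixpoint chain (p : list Node) : Prop :=
  match p with
  | [] => True
  | x :: r =>
      match r with
      | [] => True
      | y :: _ => fst x <> fst y /\ inT (snd x) (fst x) (fst y) /\ chain r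
      end
  end.

Definition trail (p : list Node) : Prop :=
  p <> [] /\ Forall (fun x => inB (fst x)) p /\ chain p.

Definition ends (p : list Node) (t : Tri) : Prop :=
  exists pre k, p = pre ++ [(t, k)].

Fixpoint setlast (p : list Node) (l : I3) : list Node :=
  match p with
  | [] => []
  | x :: r =>
      match r with
      | [] => [(fst x, l)]
      | _ => x :: setlast r l
      end
  end.

Definition tstep (p q : list Node) : Prop :=
  trail p /\ trail q /\
  ( (exists pre post t s l k,
        p = pre ++ [(t, l); (s, l); (t, k)] ++ post /\
        q = pre ++ [(t, k)] ++ post)
    \/ (exists pre t s l n, l <> n /\
        p = pre ++ [(t, l); (s, n)] /\ q = pre ++ [(t, n)])
    \/ (exists pre t l k, inE l k t /\
        p = pre ++ [(t, l)] /\ q = pre ++ [(t, k)]) ).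

Definition teq : list Node -> list Node -> Prop :=
  clos_refl_sym_trans (list Node) tstep.

Definition Cls : Type := list Node -> Prop.
Definition cls (p : list Node) : Cls := fun q => trail q /\ teq p q.

Definition inU (u : Cls) : Prop := exists p, trail p /\ u = cls p.

Definition Pt : Type := (Cls * Cls * Cls)%type.
Definition Set3 : Type := Pt -> Prop.

Definition inU3 (v : Pt) : Prop :=
  inU (get v I0) /\ inU (get v I1) /\ inU (get v I2).

Definition Rt (t : Tri) : Set3 := fun v =>
  exists p, trail p /\ ends p t /\
    v = (cls (setlast p I0), cls (setlast p I1), cls (setlast p I2)).

Definition Vset : Set3 := fun v => exists t, inB t /\ Rt t v.

Definition cyl (k : I3) (X : Set3) : Set3 := fun v =>
  inU3 v /\ exists u, X u /\ forall l, l <> k -> get u l = get v l.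
Definition diag (k l : I3) : Set3 := fun v => inU3 v /\ get v k = get v l.
Definition scompl (X : Set3) : Set3 := fun v => inU3 v /\ ~ X v.
Definition sunion (X Y : Set3) : Set3 := fun v => X v \/ Y v.
Definition sinter (X Y : Set3) : Set3 := fun v => X v /\ Y v.
Definition bigunion (F : Set3 -> Prop) : Set3 := fun v => exists X, F X /\ X v.

Inductive Cgen : Set3 -> Prop :=
| Cg_R : forall t, inB t -> Cgen (Rt t)
| Cg_union : forall X Y, Cgen X -> Cgen Y -> Cgen (sunion X Y)
| Cg_compl : forall X, Cgen X -> Cgen (scompl X)
| Cg_cyl : forall k X, Cgen X -> Cgen (cyl k X)
| Cg_diag : forall k l, Cgen (diag k l)
| Cg_bigunion : forall F, (forall X, F X -> Cgen X) -> Cgen (bigunion F).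

Definition inRl (X : Set3) : Prop := Cgen X /\ (forall v, X v -> Vset v).
Definition rcyl (k : I3) (X : Set3) : Set3 := fun v => Vset v /\ cyl k X v.
Definition rdiag (k l : I3) : Set3 := fun v => Vset v /\ diag k l v.
Definition rcompl (X : Set3) : Set3 := fun v => Vset v /\ ~ X v.

Definition empty3 : Set3 := fun _ => False.

Definition Rl_atom (X : Set3) : Prop :=
  inRl X /\ X <> empty3 /\
  forall Y, inRl Y -> (forall v, Y v -> X v) -> Y = empty3 \/ Y = X.

Definition inRa (X : Set3) : Prop := inRl X /\ rcyl I2 X = X.
Definition ra_comp (x y : Set3) : Set3 :=
  rcyl I2 (sinter (rcyl I1 (sinter (rdiag I1 I2) x))
                  (rcyl I0 (sinter (rdiag I0 I2) y))).
Definition ra_conv (x : Set3) : Set3 :=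
  rcyl I2 (sinter (rdiag I2 I0)
    (rcyl I0 (sinter (rdiag I0 I1) (rcyl I1 (sinter (rdiag I1 I2) x))))).
Definition ra_id : Set3 := rdiag I0 I1.

Definition iso_to_Ra : Prop :=
  exists f : car A -> Set3,
    (forall a, inRa (f a)) /\
    (forall a b, f a = f b -> a = b) /\
    (forall X, inRa X -> exists a, f a = X) /\
    (forall a b, f (a + b) = sunion (f a) (f b)) /\
    (forall a, f (- a) = rcompl (f a)) /\
    (forall a b, f (wcomp A a b) = ra_comp (f a) (f b)) /\
    (forall a, f (wconv A a) = ra_conv (f a)) /\
    f (wid A) = ra_id.

End Construction.

(* Main.v *)
(* Points of [U] live on the universal cover of the graph of triangles with edges [T_k]: a point is
   a reduced walk together with an index, up to moving along [T_k] at an index different from [k]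
   and up to exchanging two indices of a triangle whose edge between them is labelled by an
   identity atom.  Two arguments carry the proof.

   Labels: cutting backtracks off a walk gives a unique reduced walk, and pulling the vertices of
   its last triangle back along it to the first one only uses identity edges, so the label of the
   edge between two points of a common triangle does not depend on the triangle.  In a weakly
   associative algebra, the domain of an edge is the same for all edges of a triangle at a vertex,
   which makes this also true of degenerate edges.  Hence the [Rt t] are disjoint, two points of a
   triangle coincide exactly on [E_kl], and [C_k] relativized to [V] acts on the [Rt t] as [T_k].

   Homogeneity: two trails ending at the same triangle differ by a prefixed walk, and prefixing
   extends to a permutation of [U] that preserves all the [Rt t].  So every set in the generated
   algebra contains or misses each [Rt t], and the relativized algebra consists of the unions of
   the [Rt t]; it is the complex algebra of the suitable structure.  An element [a] of the algebra
   is sent to the union of the [Rt t] whose edge from 0 to 1, [get t I2], lies below [a]. *)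

Require Import Defs.
From Stdlib Require Import List Relations Classical ClassicalEpsilon.
From Stdlib Require Import FunctionalExtensionality PropExtensionality.
Import ListNotations.

Section Algebra.
Variable A : WAsig.
Hypothesis HA : is_WA A.

Local Notation "x + y" := (wplus A x y).
Local Notation "- x" := (wcompl A x).
Local Notation "x <= y" := (wle A x y).
Local Notation "x ;; y" := (wcomp A x y) (at level 40, left associativity).
Local Notation "x ˘" := (wconv A x) (at level 1, format "x ˘").
Local Notation e := (wid A).
Local Notation top := (wtop A).
Local Notation bot := (wbot A).
Local Notation meet := (wmeet A).
Local Notation atom := (is_atom A).

(** * Boolean algebra from Huntington's axiom *)

Lemma plusC x y : x + y = y + x.
Proof. apply HA. Qed.
Lemma plusA x y z : x + (y + z) = x + y + z.
Proof. apply HA. Qed.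
Lemma huntington x y : - (- x + - y) + - (- x + y) = x.
Proof. apply HA. Qed.

Lemma plusCA x y z : x + (y + z) = y + (x + z).
Proof. now rewrite plusA, (plusC x y), <- plusA. Qed.

(* Expanding both sides by Huntington's axiom gives the same four summands. *)
Lemma excluded_middle_const x y : x + - x = y + - y.
Proof.
  pose proof (huntington x (- y)) as H1. pose proof (huntington (- x) (- y)) as H2.
  pose proof (huntington y (- x)) as H3. pose proof (huntington (- y) (- x)) as H4.
  rewrite (plusC (- y)) in H3. rewrite (plusC (- y) (- x)) in H3.
  rewrite (plusC (- - y)) in H4. rewrite (plusC (- - y) (- x)) in H4.
  transitivity ((- (- x + - - y) + - (- x + - y)) + (- (- - x + - - y) + - (- - x + - y))).
  { now rewrite H1, H2. }
  transitivity ((- (- - x + - y) + - (- x + - y)) + (- (- - x + - - y) + - (- x + - - y))).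
  2: now rewrite H3, H4.
  generalize (- (- x + - - y)) (- (- x + - y)) (- (- - x + - - y)) (- (- - x + - y)).
  intros p q r s. rewrite <- !plusA. rewrite (plusCA s q), (plusCA p q). f_equal.
  now rewrite (plusC p), (plusCA s r), <- plusA.
Qed.

(** Huntington's axiom splits [- - x] along [- x] and [x] along [- - x]. The expansions share one
    summand, and the others agree because [x + - x] is constant. *)
Lemma complK x : - - x = x.
Proof.
  rewrite <- (huntington (- - x) (- x)). rewrite <- (huntington x (- - x)) at 5.
  rewrite (plusC (- - - x) (- - x)), (excluded_middle_const (- - x) (- x)).
  rewrite (plusC (- - - x)). apply plusC.
Qed.

Lemma excluded_middle x : x + - x = top.
Proof. apply excluded_middle_const. Qed.

Lemma bot_eq : bot = - top.
Proof. reflexivity. Qed.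

Lemma top_plus_bot : top + bot = top.
Proof. apply excluded_middle. Qed.

(** Huntington's axiom at [bot] shows that [bot], hence [top], absorbs [- (top + top)]; the excluded
    middle for [top + top] then collapses. *)
Lemma top_plus_top : top + top = top.
Proof.
  assert (H1 : - (top + top) + bot = bot).
  { pose proof (huntington bot bot) as H. rewrite bot_eq, complK in H.
    rewrite <- bot_eq, top_plus_bot in H. exact H. }
  assert (H2 : top + - (top + top) = top).
  { rewrite <- top_plus_bot at 1. rewrite <- plusA, (plusC bot), H1. apply top_plus_bot. }
  rewrite <- (excluded_middle (top + top)) at 3. rewrite <- plusA, H2. reflexivity.
Qed.

Lemma plus_bot x : x + bot = x.
Proof.
  assert (H0 : bot + bot = bot).
  { pose proof (huntington bot bot) as H. rewrite bot_eq, complK in H.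
    rewrite <- bot_eq, top_plus_bot, top_plus_top in H. exact H. }
  pose proof (huntington x x) as H.
  rewrite (plusC (- x) x), excluded_middle, <- bot_eq in H.
  rewrite <- H. rewrite <- plusA, H0. reflexivity.
Qed.

Lemma plus_idem x : x + x = x.
Proof.
  pose proof (huntington (- x) (- x)) as H.
  rewrite complK, excluded_middle, <- bot_eq, plus_bot in H.
  rewrite <- (complK (x + x)), H. apply complK.
Qed.

Lemma le_refl x : x <= x.
Proof. apply plus_idem. Qed.

Lemma le_trans x y z : x <= y -> y <= z -> x <= z.
Proof. unfold wle. intros H1 H2. rewrite <- H2, plusA, H1. reflexivity. Qed.

Lemma le_antisym x y : x <= y -> y <= x -> x = y.
Proof. unfold wle. intros H1 H2. rewrite <- H2, plusC. exact H1. Qed.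

Lemma le_plus_l x y : x <= x + y.
Proof. unfold wle. now rewrite plusA, plus_idem. Qed.

Lemma le_plus_r x y : y <= x + y.
Proof. rewrite plusC. apply le_plus_l. Qed.

Lemma plus_lub x y z : x <= z -> y <= z -> x + y <= z.
Proof. unfold wle. intros H1 H2. now rewrite <- plusA, H2. Qed.

Lemma le_top x : x <= top.
Proof. rewrite <- (excluded_middle x). apply le_plus_l. Qed.

Lemma bot_le x : bot <= x.
Proof. unfold wle. rewrite plusC. apply plus_bot. Qed.

Lemma le_bot x : x <= bot -> x = bot.
Proof. intros H. apply le_antisym; auto using bot_le. Qed.

Lemma meet_split x y : meet x y + meet x (- y) = x.
Proof. unfold wmeet. rewrite complK. apply huntington. Qed.

Lemma meet_le_l x y : meet x y <= x.
Proof. rewrite <- (meet_split x y) at 2. apply le_plus_l. Qed.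

Lemma meet_le_r x y : meet x y <= y.
Proof. unfold wmeet. rewrite plusC. apply meet_le_l. Qed.

Lemma compl_anti x y : x <= y -> - y <= - x.
Proof.
  intros H. rewrite <- H. rewrite <- (complK x) at 1. rewrite <- (complK y) at 1.
  apply meet_le_l.
Qed.

Lemma meet_glb x y z : z <= x -> z <= y -> z <= meet x y.
Proof.
  intros H1 H2. unfold wmeet. rewrite <- (complK z). apply compl_anti.
  apply plus_lub; now apply compl_anti.
Qed.

Lemma le_compl_bot z x : z <= x -> z <= - x -> z = bot.
Proof.
  intros H1 H2. apply le_bot. apply le_trans with (meet x (- x)).
  - now apply meet_glb.
  - unfold wmeet. rewrite complK, plusC, excluded_middle. apply le_refl.
Qed.

Lemma not_le_meet x y : ~ x <= y -> meet x (- y) <> bot.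
Proof.
  intros H E. apply H. rewrite <- (meet_split x y), E, plus_bot. apply meet_le_r.
Qed.

Lemma atom_le_compl z x : atom z -> ~ z <= x -> z <= - x.
Proof.
  intros [Hz H] Hn. destruct (H (meet z (- x)) (meet_le_l _ _)) as [E|E].
  - exfalso. now apply (not_le_meet z x).
  - rewrite <- E. apply meet_le_r.
Qed.

Lemma atom_not_le_compl z x : atom z -> z <= x -> z <= - x -> False.
Proof. intros [Hz _] H1 H2. apply Hz. now apply le_compl_bot with x. Qed.

Lemma atom_le_plus z x y : atom z -> z <= x + y -> z <= x \/ z <= y.
Proof.
  intros Hz H. apply NNPP. intros Hn. apply not_or_and in Hn. destruct Hn as [H1 H2].
  apply (atom_not_le_compl z (x + y) Hz H).
  rewrite <- (complK x), <- (complK y). apply meet_glb; now apply atom_le_compl.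
Qed.

Lemma atom_le_atom z y : atom z -> atom y -> z <= y -> z = y.
Proof. intros [Hz _] [_ H] Hl. destruct (H z Hl); [contradiction|assumption]. Qed.

Hypothesis Hat : is_atomic A.

Lemma le_from_atoms x y : (forall a, atom a -> a <= x -> a <= y) -> x <= y.
Proof.
  intros H. apply NNPP. intros Hn. destruct (Hat _ (not_le_meet _ _ Hn)) as [a [Ha Hle]].
  apply (atom_not_le_compl a y Ha).
  - apply H; auto. eapply le_trans; [exact Hle|apply meet_le_l].
  - eapply le_trans; [exact Hle|apply meet_le_r].
Qed.

Lemma eq_from_atoms x y : (forall a, atom a -> (a <= x <-> a <= y)) -> x = y.
Proof. intros H. apply le_antisym; apply le_from_atoms; intros a Ha; apply H; auto. Qed.

(** * Composition, converse and the cycle laws *)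

Lemma wa_axiom x : x <= e -> x ;; top ;; top = x ;; top.
Proof.
  intros H. assert (E : meet x e = x).
  { apply le_antisym; [apply meet_le_l|]. apply meet_glb; auto using le_refl. }
  rewrite <- E. apply HA.
Qed.

Lemma compDl x y z : (x + y) ;; z = x ;; z + y ;; z.
Proof. apply HA. Qed.
Lemma comp1 x : x ;; e = x.
Proof. apply HA. Qed.
Lemma convK x : x˘˘ = x.
Proof. apply HA. Qed.
Lemma convD x y : (x + y)˘ = x˘ + y˘.
Proof. apply HA. Qed.
Lemma convM x y : (x ;; y)˘ = y˘ ;; x˘.
Proof. apply HA. Qed.
Lemma tarski x y : x˘ ;; - (x ;; y) <= - y.
Proof. apply HA. Qed.

Lemma conv_inj x y : x˘ = y˘ -> x = y.
Proof. intros H. now rewrite <- (convK x), H, convK. Qed.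

Lemma conv_le x y : x <= y -> x˘ <= y˘.
Proof. unfold wle. intros H. now rewrite <- convD, H. Qed.

Lemma conv_le_iff x y : x˘ <= y <-> x <= y˘.
Proof. split; intros H; apply conv_le in H; now rewrite convK in H. Qed.

Lemma comp_le_l x y z : x <= y -> x ;; z <= y ;; z.
Proof. unfold wle. intros H. now rewrite <- compDl, H. Qed.

Lemma comp_le_r x y z : x <= y -> z ;; x <= z ;; y.
Proof.
  intros H. rewrite <- (convK (z ;; x)), <- (convK (z ;; y)). apply conv_le.
  rewrite !convM. apply comp_le_l, conv_le, H.
Qed.

Lemma comp_le x y z w : x <= y -> z <= w -> x ;; z <= y ;; w.
Proof. intros H1 H2. eapply le_trans; [apply comp_le_l, H1|apply comp_le_r, H2]. Qed.

Lemma conv_bot : bot˘ = bot.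
Proof. apply le_bot, conv_le_iff, bot_le. Qed.

Lemma conv_atom a : atom a -> atom a˘.
Proof.
  intros [H1 H2]. split.
  - intros E. apply H1. rewrite <- (convK a), E. apply conv_bot.
  - intros y Hy. apply conv_le in Hy. rewrite convK in Hy. destruct (H2 _ Hy) as [E|E].
    + left. apply conv_inj. now rewrite E, conv_bot.
    + right. now rewrite <- E, convK.
Qed.

Lemma conv_id : e˘ = e.
Proof.
  pose proof (convM e˘ e) as H. now rewrite comp1, convK, comp1 in H.
Qed.

Lemma id_comp x : e ;; x = x.
Proof. apply conv_inj. now rewrite convM, conv_id, comp1. Qed.

(** Otherwise [b] lies below [- (x˘ ;; c)], and Tarski's axiom for [x˘] gives [c <= - c]. *)
Lemma cycle_l x b c : atom b -> atom c -> c <= x ;; b -> b <= x˘ ;; c.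
Proof.
  intros Hb Hc H. apply NNPP. intros Hn. apply atom_le_compl in Hn; auto.
  apply (atom_not_le_compl c c Hc (le_refl c)).
  eapply le_trans; [exact H|]. eapply le_trans; [apply comp_le_r, Hn|].
  rewrite <- (convK x) at 1. apply tarski.
Qed.

Lemma cycle_r a x c : atom a -> atom c -> c <= a ;; x -> a <= c ;; x˘.
Proof.
  intros Ha Hc H. apply conv_le in H. rewrite convM in H.
  apply cycle_l in H; auto using conv_atom. apply conv_le in H.
  rewrite convM, !convK in H. exact H.
Qed.

(** If no atom of [y] worked, the cycle law would put all of them, hence [y], below [- (x˘ ;; c)],
    and Tarski's axiom would give [c <= - c]. *)
Lemma comp_atom_r x y c :
  atom c -> c <= x ;; y -> exists b, atom b /\ b <= y /\ c <= x ;; b.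
Proof.
  intros Hc H. apply NNPP. intros Hn.
  assert (Hy : y <= - (x˘ ;; c)).
  { apply le_from_atoms. intros b Hb Hby. apply atom_le_compl; auto. intros Hbc.
    apply Hn. exists b. repeat split; try apply Hb; auto.
    apply cycle_l in Hbc; auto. now rewrite convK in Hbc. }
  apply (atom_not_le_compl c c Hc (le_refl c)).
  eapply le_trans; [exact H|]. eapply le_trans; [apply comp_le_r, Hy|].
  rewrite <- (convK x) at 1. apply tarski.
Qed.

Lemma comp_atom_l x y c :
  atom c -> c <= x ;; y -> exists a, atom a /\ a <= x /\ c <= a ;; y.
Proof.
  intros Hc H. apply conv_le in H. rewrite convM in H.
  apply comp_atom_r in H; auto using conv_atom. destruct H as [b [Hb [H1 H2]]].
  exists b˘. split; [auto using conv_atom|]. split; [now apply conv_le_iff|].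
  apply conv_le in H2. now rewrite convM, !convK in H2.
Qed.

(** Some atom [b <= e] has [a <= a ;; b <= b], so [b = a] and [a <= a ;; a]; the cycle law turns
    this into [a <= a ;; a˘ <= a˘]. *)
Lemma atom_conv_id a : atom a -> a <= e -> a˘ = a.
Proof.
  intros Ha H. assert (H1 : a <= a ;; e) by (rewrite comp1; apply le_refl).
  apply comp_atom_r in H1; auto. destruct H1 as [b [Hb [Hbe H1]]].
  assert (Hab : a <= b).
  { eapply le_trans; [exact H1|]. rewrite <- (id_comp b) at 2. now apply comp_le_l. }
  apply atom_le_atom in Hab; auto. subst b.
  apply cycle_r in H1; auto. symmetry. apply atom_le_atom; auto using conv_atom.
  eapply le_trans; [exact H1|]. rewrite <- (id_comp a˘) at 2. now apply comp_le_l.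
Qed.

Lemma conv_sub_id x : x <= e -> x˘ = x.
Proof.
  assert (G : forall y, y <= e -> y <= y˘).
  { intros y H. apply le_from_atoms. intros a Ha Hay.
    rewrite <- (atom_conv_id a); eauto using conv_le, le_trans. }
  intros H. apply le_antisym; auto. apply conv_le_iff. auto.
Qed.

Lemma conv_le_id x : x˘ <= e <-> x <= e.
Proof. rewrite conv_le_iff, conv_id. reflexivity. Qed.

(** * Domains as elements below the identity *)

Definition dom (x : car A) : car A := meet e (x ;; top).

Lemma dom_le_id x : dom x <= e.
Proof. apply meet_le_l. Qed.

Lemma le_dom_iff u x : u <= dom x <-> u <= e /\ u <= x ;; top.
Proof.
  split.
  - intros H. split; eapply le_trans; try exact H; [apply meet_le_l|apply meet_le_r].
  - intros [H1 H2]. now apply meet_glb.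
Qed.

Lemma dom_swap a u : atom a -> atom u -> (u <= a ;; top <-> a <= u ;; top).
Proof.
  assert (G : forall a u, atom a -> atom u -> u <= a ;; top -> a <= u ;; top).
  { intros b v Hb Hv H. apply cycle_r in H; auto. eapply le_trans; [exact H|].
    apply comp_le_r, le_top. }
  split; apply G; auto.
Qed.

(* The only place where weak associativity is used. *)
Lemma dom_comp a b c : atom a -> atom b -> atom c -> c <= a ;; b -> dom c = dom a.
Proof.
  assert (G : forall u a b c, atom a -> atom c -> atom u -> u <= e -> c <= a ;; b ->
              u <= a ;; top -> u <= c ;; top).
  { intros u a' b' c' Ha Hc Hu Hue H H1. apply dom_swap; auto. apply dom_swap in H1; auto.
    (* Since [a' <= u ;; top], [c' <= a' ;; b' <= u ;; top ;; top], which collapses to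
       [u ;; top]. *)
    rewrite <- wa_axiom; auto. eapply le_trans; [exact H|]. apply comp_le; auto using le_top. }
  intros Ha Hb Hc H. apply eq_from_atoms. intros u Hu. rewrite !le_dom_iff.
  split; intros [H1 H2]; split; auto.
  - apply cycle_r in H; auto. eapply (G u c); eauto.
  - eapply (G u a); eauto.
Qed.

(** An atom [u] below [dom a] has [a <= u ;; d] for some atom [d]. The cycle law gives
    [d <= u ;; a <= a], so [d = a], and then [a <= u ;; a <= u]. *)
Lemma dom_id_atom a : atom a -> a <= e -> dom a = a.
Proof.
  intros Ha H. apply le_antisym.
  - apply le_from_atoms. intros u Hu. rewrite le_dom_iff. intros [H1 H2].
    apply comp_atom_r in H2; auto. destruct H2 as [b [Hb [_ H2]]].
    apply cycle_r, comp_atom_r in H2; auto. destruct H2 as [d [Hd [_ H2]]].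
    apply cycle_l in H2; auto. rewrite (atom_conv_id u) in H2; auto.
    assert (Hda : d <= a).
    { eapply le_trans; [exact H2|]. rewrite <- (id_comp a) at 2. now apply comp_le_l. }
    apply atom_le_atom in Hda; auto. subst d.
    assert (Hau : a <= u).
    { eapply le_trans; [exact H2|]. rewrite <- (comp1 u) at 2. now apply comp_le_r. }
    apply atom_le_atom in Hau; auto. subst u. apply le_refl.
  - apply le_dom_iff. split; auto. rewrite <- (comp1 a) at 1. apply comp_le_r, le_top.
Qed.

(** * Edge labels of a triangle *)

(* A triangle is read as a network on the vertices 0, 1, 2 in which [get s k] labels the edge
   opposite to [k], directed from the smaller to the larger endpoint. *)
Definition lab (s : Tri A) (i j : I3) : car A :=
  match i, j with
  | I0, I1 => get s I2 | I1, I0 => (get s I2)˘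
  | I1, I2 => get s I0 | I2, I1 => (get s I0)˘
  | I0, I2 => get s I1 | I2, I0 => (get s I1)˘
  | I0, I0 => dom (get s I2)
  | I1, I1 => dom (get s I0)
  | I2, I2 => dom (get s I1)˘
  end.

Lemma lab_atom s i j : inB A s -> i <> j -> atom (lab s i j).
Proof. intros [H0 [H1 [H2 _]]] Hij. destruct i, j; try congruence; simpl; auto using conv_atom. Qed.

Lemma lab_conv_neq s i j : i <> j -> lab s j i = (lab s i j)˘.
Proof. intros Hij. destruct i, j; try congruence; simpl; now rewrite ?convK. Qed.

(** The six cases are the orientations of one triangle: [inB] states one of them, and the cycle laws
    and converse give the others. *)
Lemma lab_tri s i j k : inB A s -> i <> j -> j <> k -> i <> k ->
  lab s i k <= lab s i j ;; lab s j k.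
Proof.
  intros [H0 [H1 [H2 H]]] Hij Hjk Hik.
  assert (H' := conv_le _ _ H). rewrite convM in H'.
  destruct i, j, k; try congruence; cbn [lab].
  - exact H.
  - apply cycle_r; auto.
  - apply cycle_l; auto.
  - rewrite <- (convK (get s I0)). apply cycle_l; auto using conv_atom.
  - rewrite <- (convK (get s I2)). apply cycle_r; auto using conv_atom.
  - exact H'.
Qed.

(** [lab] reads each diagonal label off one chosen edge; [dom_comp] makes it independent of that
    choice. *)
Lemma lab_dom s i j : inB A s -> i <> j -> lab s i i = dom (lab s i j).
Proof.
  intros Hs Hij.
  assert (G : forall k, i <> k -> j <> k -> dom (lab s i j) = dom (lab s i k)).
  { intros k Hik Hjk. apply dom_comp with (lab s k j); auto using lab_atom, lab_tri. }
  destruct i, j; try congruence; try reflexivity.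
  - rewrite (G I1); [reflexivity|congruence|congruence].
  - rewrite (G I2); [reflexivity|congruence|congruence].
  - rewrite (G I0); [reflexivity|congruence|congruence].
Qed.

Lemma I3_eq_dec (i j : I3) : {i = j} + {i <> j}.
Proof. decide equality. Qed.

Lemma lab_diag_le s i : lab s i i <= e.
Proof. destruct i; apply dom_le_id. Qed.

Lemma lab_conv s i j : lab s j i = (lab s i j)˘.
Proof.
  destruct (I3_eq_dec i j) as [<-|H]; [|now apply lab_conv_neq].
  symmetry. apply conv_sub_id, lab_diag_le.
Qed.

Lemma lab_sym_le s i j : lab s i j <= e -> lab s j i <= e.
Proof. intros H. rewrite lab_conv. now apply conv_le_id. Qed.

(** Off the diagonal, the triangle inequality through [i'] compares two atoms; on the diagonal, an
    identity atom is its own domain. *)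
Lemma lab_replace_l s i i' j : inB A s -> lab s i i' <= e -> lab s i j = lab s i' j.
Proof.
  intros Hs H. destruct (I3_eq_dec i i') as [<-|Hi]; auto.
  pose proof (lab_atom s i i' Hs Hi) as Ha.
  assert (E : lab s i' i = lab s i i') by (rewrite lab_conv; now apply conv_sub_id).
  destruct (I3_eq_dec j i) as [->|Hj]; [|destruct (I3_eq_dec j i') as [->|Hj']].
  - rewrite (lab_dom s i i'), E; auto. now apply dom_id_atom.
  - rewrite (lab_dom s i' i), E; auto. symmetry. now apply dom_id_atom.
  - apply atom_le_atom; auto using lab_atom. rewrite <- (id_comp (lab s i' j)).
    eapply le_trans; [apply (lab_tri s i i' j)|apply comp_le_l]; auto.
Qed.

Lemma lab_replace s i i' j j' : inB A s -> lab s i i' <= e -> lab s j j' <= e ->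
  lab s i j = lab s i' j'.
Proof.
  intros Hs Hi Hj. rewrite (lab_replace_l s i i') by auto.
  rewrite (lab_conv s j i'), (lab_conv s j' i'). f_equal. now apply lab_replace_l.
Qed.

Lemma lab_id_trans s i j k : inB A s -> lab s i j <= e -> lab s j k <= e -> lab s i k <= e.
Proof. intros Hs H1 H2. now rewrite (lab_replace_l s i j). Qed.

Lemma lab_shared_edge s t k i j : inB A s -> inB A t -> get s k = get t k ->
  i <> k -> j <> k -> lab s i j = lab t i j.
Proof.
  intros Hs Ht E Hi Hj. destruct (I3_eq_dec i j) as [<-|Hij].
  (* [m] is the other end of the shared edge, so both domains are read off that edge. *)
  - assert (G : exists m, i <> m /\ m <> k).
    { destruct i, k; try congruence;
        (exists I0 + exists I1 + exists I2); split; congruence. }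
    destruct G as [m [Him Hmk]].
    rewrite (lab_dom s i m), (lab_dom t i m); auto. f_equal.
    destruct i, m, k; simpl in *; congruence.
  - destruct i, j, k; simpl in *; congruence.
Qed.

Lemma inE_lab s i j : inB A s -> (inE A i j s <-> i = j \/ lab s i j <= e).
Proof.
  intros Hs. unfold inE. split.
  - intros [_ [H|[Hij H]]]; auto. right.
    destruct i, j; try congruence; simpl in *; auto; now apply conv_le_id.
  - intros H. split; auto. destruct (I3_eq_dec i j) as [|Hij]; auto. right. split; auto.
    destruct H as [|H]; [contradiction|].
    destruct i, j; try congruence; simpl in *; auto; now apply conv_le_id.
Qed.

Lemma inE_iff s i j : inB A s -> (inE A i j s <-> lab s i j <= e).
Proof.
  intros Hs. rewrite inE_lab by auto. split; auto.
  intros [<-|H]; auto using lab_diag_le.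
Qed.

End Algebra.

(** * Trails *)

Section Trails.
Variable A : WAsig.
Local Notation node := (Tri A * I3)%type.
Implicit Types (c d s t : Tri A) (k l : I3) (p q r w : list node) (i j : I3).

Lemma trail_single t k : trail A [(t, k)] <-> inB A t.
Proof.
  unfold trail; simpl. split.
  - intros [_ [H _]]. now inversion H.
  - intros H. repeat split; auto; discriminate.
Qed.

Lemma trail_cons t k s l r :
  trail A ((t, k) :: (s, l) :: r) <->
  t <> s /\ inT A k t s /\ trail A ((s, l) :: r).
Proof.
  unfold trail. split.
  - intros [_ [H1 [H2 [H3 H4]]]]. inversion H1; subst.
    repeat split; auto; try discriminate; apply H3.
  - intros [H1 [H2 [_ [H3 H4]]]]. repeat split; auto; try discriminate; try apply H2.
    constructor; auto. apply H2.
Qed.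

Lemma trail_split_aux w c k k' r :
  trail A (w ++ (c, k) :: r) <-> trail A (w ++ [(c, k')]) /\ trail A ((c, k) :: r).
Proof.
  induction w as [|[t l] w IH]; simpl.
  - rewrite trail_single. split; [|tauto]. intros H. split; auto.
    destruct H as [_ [H _]]. now inversion H.
  - destruct w as [|[s m] w]; simpl in *; rewrite !trail_cons; tauto.
Qed.

(** The index [I0] is a placeholder: being a trail does not depend on the last index. *)
Definition link w c : Prop := trail A (w ++ [(c, I0)]).

Lemma trail_app w c k r : trail A (w ++ (c, k) :: r) <-> link w c /\ trail A ((c, k) :: r).
Proof. apply trail_split_aux. Qed.

Lemma link_inB w c : link w c -> inB A c.
Proof. intros H. apply trail_app in H. now apply trail_single with I0. Qed.

Lemma link_trail w c k : link w c <-> trail A (w ++ [(c, k)]).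
Proof.
  rewrite trail_app, trail_single. split; [|tauto]. intros H. split; eauto using link_inB.
Qed.

Lemma setlast_app w t k l : setlast A (w ++ [(t, k)]) l = w ++ [(t, l)].
Proof.
  induction w as [|x w IH]; simpl; auto. rewrite IH.
  destruct w; reflexivity.
Qed.

(** * Equivalence of trails and prefixing *)

Definition hd_tri p : option (Tri A) := option_map fst (hd_error p).

(** Since the first triangle is an invariant, a prefix can be chosen separately for each first
    triangle. *)
Lemma tstep_hd p q : tstep A p q -> hd_tri p = hd_tri q.
Proof.
  intros [_ [_ [H|[H|H]]]].
  - destruct H as [pre [post [t [s [l [k [-> ->]]]]]]]. now destruct pre.
  - destruct H as [pre [t [s [l [n [_ [-> ->]]]]]]]. now destruct pre.
  - destruct H as [pre [t [l [k [_ [-> ->]]]]]]. now destruct pre.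
Qed.

Lemma teq_refl p : teq A p p.
Proof. apply rst_refl. Qed.
Lemma teq_sym p q : teq A p q -> teq A q p.
Proof. apply rst_sym. Qed.
Lemma teq_trans p q r : teq A p q -> teq A q r -> teq A p r.
Proof. apply rst_trans. Qed.

Lemma teq_hd p q : teq A p q -> hd_tri p = hd_tri q.
Proof. induction 1; try congruence. now apply tstep_hd. Qed.

Lemma teq_trail p q : teq A p q -> (trail A p <-> trail A q).
Proof. induction 1; try tauto. destruct H; tauto. Qed.

Lemma trail_hd_app w p : trail A p -> (forall c, hd_tri p = Some c -> link w c) -> trail A (w ++ p).
Proof.
  destruct p as [|[c k] p]; [now intros [[] _]|]. intros H1 H2.
  apply trail_app. split; auto.
Qed.

Lemma tstep_prefix w p q : (forall c, hd_tri p = Some c -> link w c) ->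
  tstep A p q -> tstep A (w ++ p) (w ++ q).
Proof.
  intros Hw H. pose proof (tstep_hd _ _ H) as Hh.
  destruct H as [Hp [Hq H]]. split; [|split].
  - now apply trail_hd_app.
  - apply trail_hd_app; auto. now rewrite <- Hh.
  - destruct H as [H|[H|H]].
    + left. destruct H as [pre [post [t [s [l [k [-> ->]]]]]]].
      exists (w ++ pre), post, t, s, l, k. now rewrite <- !app_assoc.
    + right; left. destruct H as [pre [t [s [l [n [Hn [-> ->]]]]]]].
      exists (w ++ pre), t, s, l, n. now rewrite <- !app_assoc.
    + right; right. destruct H as [pre [t [l [k [Hk [-> ->]]]]]].
      exists (w ++ pre), t, l, k. now rewrite <- !app_assoc.
Qed.

Lemma teq_prefix w p q : (forall c, hd_tri p = Some c -> link w c) ->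
  teq A p q -> teq A (w ++ p) (w ++ q).
Proof.
  intros Hw H. revert Hw. induction H as [p q H| |p q H IH|p q r H1 IH1 H2 IH2]; intros Hw.
  - apply rst_step. now apply tstep_prefix.
  - apply teq_refl.
  - apply teq_sym, IH. now rewrite (teq_hd _ _ H).
  - eapply teq_trans; [now apply IH1|]. apply IH2. now rewrite <- (teq_hd _ _ H1).
Qed.

Lemma teq_prefix_at w c k r q : link w c -> teq A ((c, k) :: r) q -> teq A (w ++ (c, k) :: r) (w ++ q).
Proof. intros H. apply teq_prefix. intros c' E. injection E as <-. exact H. Qed.

Lemma teq_backtrack pre t s l k post : trail A (pre ++ (t, l) :: (s, l) :: (t, k) :: post) ->
  teq A (pre ++ (t, l) :: (s, l) :: (t, k) :: post) (pre ++ (t, k) :: post).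
Proof.
  intros H. apply rst_step. split; [exact H|]. split.
  - apply trail_app in H. rewrite !trail_cons in H. apply trail_app. tauto.
  - left. now exists pre, post, t, s, l, k.
Qed.

(* A walk is a trail without its last node; [origin w c] is the first triangle of the walk [w]
   leading to [c], and [winv w c] is the reverse walk, leading from [c] to [origin w c]. *)
Definition origin w c : Tri A := match w with [] => c | x :: _ => fst x end.

Fixpoint winv w c : list node :=
  match w with
  | [] => []
  | (t, k) :: w' => winv w' c ++ [(origin w' c, k)]
  end.

Lemma inT_sym k t s : inT A k t s -> inT A k s t.
Proof. unfold inT. intuition. Qed.

Lemma origin_app w c k r : exists k' r', w ++ (c, k) :: r = (origin w c, k') :: r'.
Proof. destruct w as [|[t l] w]; simpl; eauto. Qed.

Lemma link_cons t k w c : link ((t, k) :: w) c <->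
  t <> origin w c /\ inT A k t (origin w c) /\ link w c.
Proof.
  unfold link. simpl. destruct (origin_app w c I0 []) as [k' [r' E]]. rewrite E.
  apply trail_cons.
Qed.

Lemma link_snoc w t k c : link (w ++ [(t, k)]) c <-> link w t /\ t <> c /\ inT A k t c.
Proof.
  unfold link at 1. rewrite <- app_assoc. simpl. rewrite trail_app, trail_cons, trail_single.
  unfold inT. tauto.
Qed.

Lemma link_app w w' c : link w' c -> link w (origin w' c) -> link (w ++ w') c.
Proof.
  intros H1 H2. unfold link in *. rewrite <- app_assoc.
  destruct (origin_app w' c I0 []) as [k' [r' E]]. rewrite E in *. now apply trail_app.
Qed.

Lemma link_winv w c : link w c -> link (winv w c) (origin w c).
Proof.
  induction w as [|[t k] w IH]; simpl; auto.
  rewrite link_cons, link_snoc. intros [H1 [H2 H3]]. auto using inT_sym.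
Qed.

Lemma origin_winv w c : origin (winv w c) (origin w c) = c.
Proof.
  induction w as [|[t k] w IH]; simpl; auto.
  destruct (winv w c); simpl in *; auto.
Qed.

(** The backtrack where the inverse walk meets [w] is cut first; what remains is the same claim for
    a shorter walk. *)
Lemma winv_cancel_l w c k r : link w c -> trail A ((c, k) :: r) ->
  teq A (winv w c ++ w ++ (c, k) :: r) ((c, k) :: r).
Proof.
  intros Hw Hr. induction w as [|[t l] w IH]; [apply teq_refl|].
  pose proof (link_winv _ _ Hw) as Hi. rewrite link_cons in Hw. simpl in *.
  destruct Hw as [H1 [H2 H3]]. eapply teq_trans; [|apply IH; auto].
  rewrite <- app_assoc. simpl.
  assert (Ht : trail A (w ++ (c, k) :: r)) by now apply trail_app.
  destruct (origin_app w c k r) as [k' [r' E]]. rewrite E in *.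
  apply teq_backtrack. apply link_snoc in Hi. apply trail_app. rewrite !trail_cons.
  intuition.
Qed.

Lemma winv_cancel_r w c k r : link w c -> trail A ((origin w c, k) :: r) ->
  teq A (w ++ winv w c ++ (origin w c, k) :: r) ((origin w c, k) :: r).
Proof.
  revert k r. induction w as [|[t l] w IH]; intros k r Hw Hr; [apply teq_refl|].
  rewrite link_cons in Hw. simpl in *. destruct Hw as [H1 [H2 H3]].
  rewrite <- app_assoc. simpl.
  assert (Hr' : trail A ((origin w c, l) :: (t, k) :: r)).
  { apply trail_cons. auto using inT_sym. }
  (* Cancelling the inner walk first leaves a single backtrack from [t] to [origin w c] and back. *)
  specialize (IH l ((t, k) :: r) H3 Hr').
  eapply teq_trans; [apply (teq_prefix [(t, l)]); [|exact IH]|].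
  - intros d. rewrite (teq_hd _ _ IH). intros E. injection E as <-.
    apply link_cons. simpl. split; [exact H1|]. split; [exact H2|]. apply trail_single, H2.
  - apply (teq_backtrack []). simpl. apply trail_cons. auto.
Qed.

Lemma cls_eq p q : trail A p -> trail A q -> (cls A p = cls A q <-> teq A p q).
Proof.
  intros Hp Hq. split.
  - intros E. assert (H : cls A q q) by (split; auto using teq_refl).
    rewrite <- E in H. apply H.
  - intros H. apply functional_extensionality. intros r. apply propositional_extensionality.
    unfold cls. split; intros [H1 H2]; split; auto; eauto using teq_trans, teq_sym.
Qed.

Lemma trail_ends p : trail A p -> exists w t k, p = w ++ [(t, k)].
Proof.
  intros [H _]. destruct (exists_last H) as [w [[t k] ->]]. eauto.
Qed.

(** * Translations of the space of points *)

(* [P c] is a walk that is put in front of all trails starting at [c]. *)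
Definition moves (P : Tri A -> list node) (u v : Cls A) : Prop :=
  exists c k r, trail A ((c, k) :: r) /\ u = cls A ((c, k) :: r) /\ v = cls A (P c ++ (c, k) :: r).

Definition inverse_prefix (P P' : Tri A -> list node) : Prop :=
  forall c, inB A c -> link (P c) c /\
    forall k r, trail A ((c, k) :: r) ->
      teq A (P' (origin (P c) c) ++ P c ++ (c, k) :: r) ((c, k) :: r).

Definition mutual (P P' : Tri A -> list node) : Prop :=
  inverse_prefix P P' /\ inverse_prefix P' P.

Lemma trail_inB c k r : trail A ((c, k) :: r) -> inB A c.
Proof. intros [_ [H _]]. now inversion H. Qed.

Lemma moves_total P u : inU A u -> exists v, moves P u v.
Proof.
  intros [[|[c k] r] [Hp ->]]; [now destruct Hp|]. eexists. now exists c, k, r.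
Qed.

(** Equivalent trails start at the same triangle, so [P] puts the same walk in front of both. *)
Lemma moves_fun P P' u v v' : mutual P P' -> moves P u v -> moves P u v' -> v = v'.
Proof.
  intros HP [c [k [r [H1 [-> ->]]]]] [c' [k' [r' [H1' [E ->]]]]].
  apply cls_eq in E; auto. pose proof (teq_hd _ _ E) as Eh. injection Eh as <-.
  destruct (proj1 HP c (trail_inB _ _ _ H1)) as [Hl _].
  apply cls_eq; [now apply trail_app..|]. now apply teq_prefix_at.
Qed.

Lemma moves_sym P P' u v : mutual P P' -> moves P u v -> moves P' v u.
Proof.
  intros HP [c [k [r [H1 [-> ->]]]]].
  destruct (proj1 HP c (trail_inB _ _ _ H1)) as [Hl H].
  assert (Ht : trail A (P c ++ (c, k) :: r)) by now apply trail_app.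
  specialize (H k r H1). destruct (origin_app (P c) c k r) as [k' [r' E]].
  exists (origin (P c) c), k', r'. rewrite <- E. split; auto. split; auto.
  apply cls_eq; auto.
  - now apply (teq_trail _ _ H).
  - now apply teq_sym.
Qed.

Lemma moves_inU P P' u v : mutual P P' -> moves P u v -> inU A u /\ inU A v.
Proof.
  intros HP [c [k [r [H1 [-> ->]]]]].
  destruct (proj1 HP c (trail_inB _ _ _ H1)) as [Hl H].
  split; eexists; (split; [|reflexivity]); [exact H1|now apply trail_app].
Qed.

Lemma mutual_sym P P' : mutual P P' -> mutual P' P.
Proof. unfold mutual. tauto. Qed.

Lemma trail_setlast p k : trail A p -> trail A (setlast A p k).
Proof.
  intros H. destruct (trail_ends p H) as [w [t [l ->]]]. rewrite setlast_app.
  apply link_trail. exact (proj2 (link_trail _ _ _) H).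
Qed.

Lemma Rt_inU3 t v : Rt A t v -> inU3 A v.
Proof.
  intros [p [H1 [_ ->]]]. unfold inU3; simpl.
  repeat split; eexists; (split; [|reflexivity]); now apply trail_setlast.
Qed.

Lemma Cgen_inU3 X v : Cgen A X -> X v -> inU3 A v.
Proof.
  intros H. induction H as [t Ht|X Y HX IHX HY IHY|X HX IHX|k X HX IHX|k l|F HF IHF]; intros Hv.
  - now apply Rt_inU3 in Hv.
  - destruct Hv; auto.
  - apply Hv.
  - apply Hv.
  - apply Hv.
  - destruct Hv as [X [H1 H2]]. eauto.
Qed.

Lemma Rt_intro w t : link w t ->
  Rt A t (cls A (w ++ [(t, I0)]), cls A (w ++ [(t, I1)]), cls A (w ++ [(t, I2)])).
Proof.
  intros H. exists (w ++ [(t, I0)]). split; [exact H|]. split; [now exists w, I0|].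
  now rewrite !setlast_app.
Qed.

Lemma Rt_elim t v : Rt A t v -> exists w, link w t /\
  v = (cls A (w ++ [(t, I0)]), cls A (w ++ [(t, I1)]), cls A (w ++ [(t, I2)])).
Proof.
  intros [p [H1 [[w [k ->]] ->]]]. rewrite !setlast_app. exists w. split; auto.
  exact (proj2 (link_trail _ _ _) H1).
Qed.

Lemma get_pt (a : I3 -> Cls A) k : get (a I0, a I1, a I2) k = a k.
Proof. now destruct k. Qed.

Lemma pt_eta (v : Pt A) : v = (get v I0, get v I1, get v I2).
Proof. now destruct v as [[a b] c]. Qed.

(** Prefixing changes the start of a trail and keeps its last triangle. *)
Lemma Rt_moves P P' t v v' : mutual P P' ->
  (forall k, moves P (get v k) (get v' k)) -> Rt A t v -> Rt A t v'.
Proof.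
  intros HP H Hv. apply Rt_elim in Hv. destruct Hv as [w [Hw Ev]].
  set (c := origin w t).
  assert (Hc : inB A c).
  { destruct (origin_app w t I0 []) as [k' [r' E]]. unfold link in Hw. rewrite E in Hw.
    now apply trail_inB in Hw. }
  destruct (proj1 HP c Hc) as [Hl _].
  assert (Hm : forall k, get v' k = cls A ((P c ++ w) ++ [(t, k)])).
  { intros k. apply (moves_fun P P' (get v k)); auto.
    rewrite <- app_assoc. subst v. rewrite (get_pt (fun k => cls A (w ++ [(t, k)]))).
    destruct (origin_app w t k []) as [k' [r' E]]. rewrite E. fold c. exists c, k', r'.
    split; auto. unfold c. rewrite <- E. now apply link_trail. }
  rewrite (pt_eta v'), !Hm. apply Rt_intro. now apply link_app.
Qed.

(** The translation preserves the generators, so it preserves whatever the operations build from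
    them; complements use the inverse translation. *)
Lemma Cgen_moves X : Cgen A X -> forall P P' v v', mutual P P' ->
  (forall k, moves P (get v k) (get v' k)) -> X v -> X v'.
Proof.
  intros H. induction H as [t Ht|X Y HX IHX HY IHY|X HX IHX|k X HX IHX|k l|F HF IHF];
    intros P P' v v' HP Hm Hv;
    assert (HU : inU3 A v') by
      exact (conj (proj2 (moves_inU _ _ _ _ HP (Hm I0)))
        (conj (proj2 (moves_inU _ _ _ _ HP (Hm I1))) (proj2 (moves_inU _ _ _ _ HP (Hm I2))))).
  - eapply Rt_moves; eauto.
  - destruct Hv as [Hv|Hv]; [left|right]; eauto.
  - split; [exact HU|].
    intros Hn. apply (proj2 Hv). apply (IHX P' P v' v); auto using mutual_sym.
    intros k. eapply moves_sym; eauto.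
  - destruct Hv as [_ [u [Hu Huv]]]. split; [exact HU|].
    assert (Hk : inU A (get u k)).
    { apply Cgen_inU3 in Hu; auto. destruct Hu as [? [? ?]]. now destruct k. }
    destruct (moves_total P (get u k) Hk) as [b Hb].
    (* The witness is [v'] with its coordinate [k] replaced by the image of that of [u]. *)
    set (a := fun i => if I3_eq_dec i k then b else get v' i).
    exists (a I0, a I1, a I2). split.
    + apply (IHX P P' u); auto. intros i. rewrite get_pt. unfold a.
      destruct (I3_eq_dec i k) as [->|Hi]; auto. rewrite Huv; auto.
    + intros i Hi. rewrite get_pt. unfold a. now destruct (I3_eq_dec i k).
  - destruct Hv as [_ E]. split; [exact HU|].
    apply (moves_fun P P' (get v k)); auto. rewrite E. auto.
  - destruct Hv as [X [H1 H2]]. exists X. split; [exact H1|]. eapply IHF; eauto.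
Qed.

(* Exchanging the trails starting at [c] with those starting at [origin w c] makes the translation
   by [w] invertible on all of [U]. *)
Lemma mutual_swap w c : link w c -> exists P P', mutual P P' /\ P c = w.
Proof.
  intros Hw. set (d := origin w c).
  set (P := fun a => if excluded_middle_informative (a = c) then w else
                     if excluded_middle_informative (a = d) then winv w c else []).
  (* The tests come in the opposite order to those of [P], so that the two stay inverse when [w] is
     closed, that is, when [d = c]. *)
  set (P' := fun a => if excluded_middle_informative (a = d) then winv w c else
                      if excluded_middle_informative (a = c) then w else []).
  assert (Ec : P c = w).
  { unfold P. now destruct (excluded_middle_informative (c = c)). }
  assert (Ed : P' d = winv w c).
  { unfold P'. now destruct (excluded_middle_informative (d = d)). }
  assert (Ed' : d <> c -> P d = winv w c).
  { intros H. unfold P. destruct (excluded_middle_informative (d = c)); [easy|].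
    now destruct (excluded_middle_informative (d = d)). }
  assert (Ec' : d <> c -> P' c = w).
  { intros H. unfold P'. destruct (excluded_middle_informative (c = d)); [congruence|].
    now destruct (excluded_middle_informative (c = c)). }
  assert (Eo : forall a, a <> c -> a <> d -> P a = [] /\ P' a = []).
  { intros a H1 H2. unfold P, P'. destruct (excluded_middle_informative (a = c)); [easy|].
    now destruct (excluded_middle_informative (a = d)). }
  assert (Hi : link (winv w c) d) by now apply link_winv.
  assert (Ho : origin (winv w c) d = c) by apply origin_winv.
  exists P, P'. split; [|exact Ec]. split; intros a Ha.
  - destruct (classic (a = c)) as [->|Hac]; [|destruct (classic (a = d)) as [->|Had]].
    + rewrite Ec. fold d. rewrite Ed. auto using winv_cancel_l.
    + rewrite Ed', Ho, Ec'; auto. auto using winv_cancel_r.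
    + destruct (Eo a Hac Had) as [E1 E2]. rewrite E1. simpl. rewrite E2.
      split; [now apply trail_single|]. intros; apply teq_refl.
  - destruct (classic (a = d)) as [->|Had]; [|destruct (classic (a = c)) as [->|Hac]].
    + rewrite Ed, Ho, Ec. auto using winv_cancel_r.
    + rewrite Ec'; auto. fold d. rewrite Ed'; auto. auto using winv_cancel_l.
    + destruct (Eo a Hac Had) as [E1 E2]. rewrite E2. simpl. rewrite E1.
      split; [now apply trail_single|]. intros; apply teq_refl.
Qed.

Lemma Cgen_Rt_homogeneous X t v v' : Cgen A X -> Rt A t v -> Rt A t v' -> X v -> X v'.
Proof.
  intros HX Hv Hv'. apply Rt_elim in Hv, Hv'.
  destruct Hv as [w [Hw ->]], Hv' as [w' [Hw' ->]].
  (* Put in front of [w], this walk has its second half cancelled, which leaves [w']. *)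
  set (x := w' ++ winv w t).
  assert (Hx : link x (origin w t)).
  { apply link_app; [now apply link_winv|]. now rewrite origin_winv. }
  destruct (mutual_swap _ _ Hx) as [P [P' [HP E]]].
  apply (Cgen_moves X HX P P'); auto. intros k.
  rewrite (get_pt (fun k => cls A (w ++ [(t, k)]))), (get_pt (fun k => cls A (w' ++ [(t, k)]))).
  assert (Hwk : trail A (w ++ [(t, k)])) by now apply link_trail.
  assert (Hc : teq A (winv w t ++ w ++ [(t, k)]) [(t, k)]).
  { apply winv_cancel_l; auto. apply trail_single. eauto using link_inB. }
  destruct (origin_app w t k []) as [k' [r' E']].
  exists (origin w t), k', r'. rewrite <- E', E. split; auto. split; auto.
  assert (Ht : teq A (x ++ w ++ [(t, k)]) (w' ++ [(t, k)])).
  { unfold x. rewrite <- app_assoc. apply teq_prefix; auto. rewrite (teq_hd _ _ Hc).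
    intros c Ec. injection Ec as <-. exact Hw'. }
  apply cls_eq.
  - now apply link_trail.
  - apply (teq_trail _ _ Ht). now apply link_trail.
  - now apply teq_sym.
Qed.

End Trails.

(** * Reduced walks and equality of points *)

Section Reduced.
Variable A : WAsig.
Hypothesis HA : is_WA A.
Hypothesis Hat : is_atomic A.
Local Notation node := (Tri A * I3)%type.
Local Notation ident s i j := (wle A (lab A s i j) (wid A)).
Implicit Types (s u : Tri A) (k l i j : I3) (p q r w x y : list node).

(* A reduced walk from the root is kept in reverse order; each triangle is paired with the index
   under which it was entered. *)
Variable root : Tri A.
Hypothesis Hroot : inB A root.

Definition tip x : Tri A := match x with [] => root | (s, _) :: _ => s end.

Fixpoint reduced x : Prop :=
  match x with
  | [] => True
  | (s, k) :: y =>
      inB A s /\ get s k = get (tip y) k /\ reduced y /\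
      match y with [] => True | (_, l) :: z => ~ (k = l /\ s = tip z) end
  end.

Definition move x k s : list node :=
  match x with
  | [] => [(s, k)]
  | (_, l) :: y => if excluded_middle_informative (k = l /\ s = tip y) then y else (s, k) :: x
  end.

Lemma reduced_tip_inB x : reduced x -> inB A (tip x).
Proof. destruct x as [|[s k] x]; simpl; tauto. Qed.

Lemma reduced_move x k s : reduced x -> inB A s -> get s k = get (tip x) k ->
  reduced (move x k s) /\ tip (move x k s) = s.
Proof.
  intros Hx Hs E. destruct x as [|[u l] y]; simpl in *; [tauto|].
  destruct (excluded_middle_informative (k = l /\ s = tip y)) as [[-> ->]|Hn]; simpl; tauto.
Qed.

(** If the first move cuts the last node of [x], moving back pushes it again instead of cutting
    further, because [x] is reduced. *)
Lemma move_back x k s : reduced x -> inB A s -> get s k = get (tip x) k ->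
  move (move x k s) k (tip x) = x.
Proof.
  intros Hx Hs E.
  assert (G : move ((s, k) :: x) k (tip x) = x).
  { simpl. destruct (excluded_middle_informative (k = k /\ tip x = tip x)); tauto. }
  destruct x as [|[u l] y]; [exact G|].
  unfold move at 2. destruct (excluded_middle_informative (k = l /\ s = tip y)) as [[-> ->]|Hn].
  - simpl in *. destruct y as [|[u' l'] z]; simpl; auto.
    destruct (excluded_middle_informative (l = l' /\ u = tip z)); tauto.
  - exact G.
Qed.

(** The last index is not consumed: it names a vertex of the last triangle, not a move. *)
Fixpoint run x p : list node :=
  match p with
  | (_, k) :: (((s, _) :: _) as r) => run (move x k s) r
  | _ => x
  end.

Lemma run_app w u k r x : run x (w ++ (u, k) :: r) = run (run x (w ++ [(u, k)])) ((u, k) :: r).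
Proof.
  revert x. induction w as [|[s l] w IH]; intros x; [reflexivity|].
  destruct w as [|[s' l'] w]; [reflexivity|]. apply IH.
Qed.

Lemma run_last w u k k' x : run x (w ++ [(u, k)]) = run x (w ++ [(u, k')]).
Proof.
  revert x. induction w as [|[s l] w IH]; intros x; [reflexivity|].
  destruct w as [|[s' l'] w]; [reflexivity|]. apply IH.
Qed.

Lemma run_reduced w u k x : reduced x -> trail A (w ++ [(u, k)]) ->
  hd_tri A (w ++ [(u, k)]) = Some (tip x) ->
  reduced (run x (w ++ [(u, k)])) /\ tip (run x (w ++ [(u, k)])) = u.
Proof.
  revert x. induction w as [|[s l] w IH]; intros x Hx Ht Hh.
  - injection Hh as ->. auto.
  - injection Hh as ->.
    assert (G : forall s' l' w', w ++ [(u, k)] = (s', l') :: w' ->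
      reduced (run x ((tip x, l) :: w ++ [(u, k)])) /\
      tip (run x ((tip x, l) :: w ++ [(u, k)])) = u).
    { intros s' l' w' E. simpl app in Ht. rewrite E in Ht |- *. apply trail_cons in Ht.
      destruct Ht as [_ [[_ [Hs' Hl]] Ht]].
      change (reduced (run (move x l s') ((s', l') :: w')) /\
        tip (run (move x l s') ((s', l') :: w')) = u).
      rewrite <- E in *.
      destruct (reduced_move x l s') as [H1 H2]; auto.
      apply IH; auto. rewrite E, H2. reflexivity. }
    destruct w as [|[s' l'] w]; eapply G; reflexivity.
Qed.

(* [sees x i l]: following the identity edges of the triangles along the reduced walk [x], and
   never moving through a triangle entered under [k] at its vertex [k], vertex [i] of the tip is
   identified with vertex [l] of the root. *)
Fixpoint sees x i l : Prop :=
  match x with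
  | [] => ident root i l
  | (s, k) :: y => exists j, j <> k /\ ident s i j /\ sees y j l
  end.

(** Both vertices are pulled back one triangle at a time: replacing them along identity edges keeps
    the label, and an edge avoiding [k] is shared with the preceding triangle. *)
Lemma sees_lab x i j l m : reduced x -> sees x i l -> sees x j m ->
  lab A (tip x) i j = lab A root l m.
Proof.
  revert i j. induction x as [|[s k] x IH]; intros i j Hx Hi Hj.
  - now apply lab_replace.
  - destruct Hx as [Hs [E [Hx _]]], Hi as [i' [Hik [Hi Hi']]], Hj as [j' [Hjk [Hj Hj']]].
    rewrite <- (IH i' j'); auto. simpl.
    rewrite (lab_replace A HA Hat s i i' j j') by auto.
    apply lab_shared_edge with k; auto using reduced_tip_inB.
Qed.

Lemma sees_ident x i j l : reduced x -> ident (tip x) i j -> sees x j l -> sees x i l.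
Proof.
  intros Hx Hi Hj. destruct x as [|[s k] x]; simpl in *.
  - eapply lab_id_trans; eauto.
  - destruct Hj as [j' [H1 [H2 H3]]]. exists j'. repeat split; auto.
    destruct Hx as [Hs _]. eapply lab_id_trans; eauto.
Qed.

(** An identity edge of [s] between vertices other than [k] is also one of [tip x], so the detour
    through [s] identifies nothing new. *)
Lemma sees_push x k s i l : reduced x -> inB A s -> get s k = get (tip x) k -> i <> k ->
  (sees ((s, k) :: x) i l <-> sees x i l).
Proof.
  intros Hx Hs E Hi. simpl. split.
  - intros [j [Hj [H1 H2]]]. apply sees_ident with j; auto.
    rewrite <- (lab_shared_edge A HA Hat s (tip x) k); auto using reduced_tip_inB.
  - intros H. exists i. repeat split; auto. now apply lab_diag_le.
Qed.

Lemma sees_move x k s i l : reduced x -> inB A s -> get s k = get (tip x) k -> i <> k ->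
  (sees (move x k s) i l <-> sees x i l).
Proof.
  intros Hx Hs E Hi. destruct x as [|[u m] y]; [now apply sees_push|]. unfold move.
  destruct (excluded_middle_informative (k = m /\ s = tip y)) as [[-> ->]|Hn].
  (* A cut is a push read backwards, from [y] to [x]. *)
  - symmetry. simpl in Hx. apply sees_push; tauto.
  - now apply sees_push.
Qed.

Definition point_sees p l : Prop := exists w u k, p = w ++ [(u, k)] /\ sees (run [] p) k l.

Lemma point_sees_last w u k l : point_sees (w ++ [(u, k)]) l <-> sees (run [] (w ++ [(u, k)])) k l.
Proof.
  split.
  - intros [w' [u' [k' [E H]]]]. apply app_inj_tail in E. destruct E as [-> E].
    injection E as -> ->. exact H.
  - intros H. now exists w, u, k.
Qed.

Lemma run_trail w u k : trail A (w ++ [(u, k)]) -> hd_tri A (w ++ [(u, k)]) = Some root ->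
  reduced (run [] (w ++ [(u, k)])) /\ tip (run [] (w ++ [(u, k)])) = u.
Proof. intros H1 H2. now apply run_reduced. Qed.

(** Cutting a backtrack leaves the reduced walk unchanged by [move_back]; dropping a last step under
    another index is [sees_move]; exchanging indices along an identity edge is [sees_ident]. *)
Lemma tstep_sees p q l : tstep A p q -> hd_tri A p = Some root -> (point_sees p l <-> point_sees q l).
Proof.
  intros [Hp [Hq H]] Hh. destruct H as [H|[H|H]].
  - destruct H as [pre [post [t [s [m [k [-> ->]]]]]]].
    assert (Hpre : trail A (pre ++ [(t, m)])).
    { apply trail_app in Hp. now apply link_trail. }
    assert (Hh' : hd_tri A (pre ++ [(t, m)]) = Some root) by now destruct pre.
    destruct (run_trail _ _ _ Hpre Hh') as [H1 H2].
    apply trail_app in Hp. destruct Hp as [_ Hp]. simpl in Hp. rewrite !trail_cons in Hp.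
    destruct Hp as [_ [[_ [Hs E]] _]].
    assert (R : run [] (pre ++ [(t, m); (s, m); (t, k)] ++ post) = run [] (pre ++ [(t, k)] ++ post)).
    { simpl app. rewrite run_app. set (x := run [] (pre ++ [(t, m)])) in *.
      rewrite (run_app pre t k), (run_last pre t k m). fold x.
      change (run (move (move x m s) m t) ((t, k) :: post) = run x ((t, k) :: post)).
      rewrite <- H2 at 1. rewrite move_back; auto. now rewrite H2. }
    assert (L : exists w1 w2 u n, pre ++ [(t, m); (s, m); (t, k)] ++ post = w1 ++ [(u, n)] /\
                                  pre ++ [(t, k)] ++ post = w2 ++ [(u, n)]).
    { assert (Hn : (t, k) :: post <> []) by discriminate.
      destruct (exists_last Hn) as [w [[u n] Ew]]. simpl. rewrite Ew.
      exists (pre ++ (t, m) :: (s, m) :: w), (pre ++ w), u, n. now rewrite <- !app_assoc. }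
    destruct L as [w1 [w2 [u [n [E1 E2]]]]]. rewrite E1, E2 in *.
    rewrite !point_sees_last, R. reflexivity.
  - destruct H as [pre [t [s [m [n [Hmn [-> ->]]]]]]].
    assert (Hpre : trail A (pre ++ [(t, m)])).
    { apply trail_app in Hp. now apply link_trail. }
    assert (Hh' : hd_tri A (pre ++ [(t, m)]) = Some root) by now destruct pre.
    destruct (run_trail _ _ _ Hpre Hh') as [H1 H2].
    apply trail_app in Hp. destruct Hp as [_ Hp]. rewrite !trail_cons in Hp.
    destruct Hp as [_ [[_ [Hs E]] _]].
    change [(t, m); (s, n)] with ([(t, m)] ++ [(s, n)]). rewrite app_assoc.
    rewrite !point_sees_last, <- app_assoc. simpl app. rewrite run_app.
    rewrite (run_last pre t n m). set (x := run [] (pre ++ [(t, m)])) in *.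
    change (sees (move x m s) n l <-> sees x n l).
    apply sees_move; auto. now rewrite H2.
  - destruct H as [pre [t [m [k [Hmk [-> ->]]]]]].
    destruct (run_trail _ _ _ Hp Hh) as [H1 H2]. rewrite !point_sees_last.
    rewrite (run_last pre t k m). set (x := run [] (pre ++ [(t, m)])) in *.
    apply inE_iff in Hmk; auto; [|now apply trail_app in Hp as [? ?%trail_single]].
    rewrite <- H2 in Hmk. split; apply sees_ident; auto. now apply lab_sym_le.
Qed.

Lemma teq_sees p q l : teq A p q -> hd_tri A p = Some root -> (point_sees p l <-> point_sees q l).
Proof.
  induction 1 as [p q H| |p q H IH|p q r H1 IH1 H2 IH2]; intros Hh.
  - now apply tstep_sees.
  - reflexivity.
  - symmetry. apply IH. rewrite <- Hh. now apply teq_hd.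
  - rewrite IH1 by auto. apply IH2. rewrite <- Hh. symmetry. now apply teq_hd.
Qed.

(** Each root vertex sees itself, equivalence carries this to the vertices of [s], and [sees_lab]
    compares the labels. *)
Lemma root_point_labels w s l m i j : trail A (w ++ [(s, i)]) ->
  teq A [(root, l)] (w ++ [(s, i)]) -> teq A [(root, m)] (w ++ [(s, j)]) ->
  lab A root l m = lab A s i j.
Proof.
  intros Ht Hl Hm.
  assert (Hh : hd_tri A (w ++ [(s, i)]) = Some root) by now rewrite <- (teq_hd _ _ _ Hl).
  assert (G : forall n, point_sees [(root, n)] n).
  { intros n. apply (point_sees_last [] root n). now apply lab_diag_le. }
  destruct (run_trail _ _ _ Ht Hh) as [H1 H2].
  pose proof (G l) as Gl. pose proof (G m) as Gm.
  rewrite (teq_sees _ _ _ Hl) in Gl by auto. rewrite (teq_sees _ _ _ Hm) in Gm by auto.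
  rewrite point_sees_last in Gl, Gm. rewrite (run_last w s j i) in Gm.
  rewrite <- H2. symmetry. eapply sees_lab; eauto.
Qed.

End Reduced.

(** * Points of a triangle, disjointness of the [Rt t], diagonals and cylinders *)

Section Points.
Variable A : WAsig.
Hypothesis HA : is_WA A.
Hypothesis Hat : is_atomic A.
Local Notation node := (Tri A * I3)%type.
Implicit Types (s t : Tri A) (k l i j : I3) (w : list node).

(** Putting the inverse of [w] in front makes [t] the root. *)
Lemma point_labels w w' t s l m i j : link A w t -> link A w' s ->
  teq A (w ++ [(t, l)]) (w' ++ [(s, i)]) -> teq A (w ++ [(t, m)]) (w' ++ [(s, j)]) ->
  lab A t l m = lab A s i j.
Proof.
  intros Hw Hw' Hl Hm.
  pose proof (link_winv _ _ _ Hw) as Hi.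
  assert (G : forall n k, teq A (w ++ [(t, n)]) (w' ++ [(s, k)]) ->
                teq A [(t, n)] ((winv A w t ++ w') ++ [(s, k)])).
  { intros n k H. eapply teq_trans.
    - apply teq_sym. apply (winv_cancel_l A w t n []); auto. apply trail_single.
      eauto using link_inB.
    - rewrite <- app_assoc. apply teq_prefix; auto.
      destruct (origin_app A w t n []) as [k' [r' E]]. rewrite E.
      intros c Ec. injection Ec as <-. exact Hi. }
  assert (Ht : inB A t) by eauto using link_inB.
  apply root_point_labels with (winv A w t ++ w'); auto.
  apply (teq_trail _ _ _ (G _ _ Hl)). now apply trail_single.
Qed.

(** Equal points force [lab t i j = lab t i i], which is below the identity; the converse is one
    step of the equivalence. *)
Lemma point_eq_iff w t i j : link A w t ->
  (teq A (w ++ [(t, i)]) (w ++ [(t, j)]) <-> inE A i j t).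
Proof.
  intros Hw. assert (Ht : inB A t) by eauto using link_inB. split.
  - intros H. apply inE_iff; auto.
    rewrite <- (point_labels w w t t i i i j); auto using lab_diag_le, teq_refl.
  - intros H. apply rst_step. split; [now apply link_trail|]. split; [now apply link_trail|].
    right; right. now exists w, t, i, j.
Qed.

Definition pt_of w t : Pt A :=
  (cls A (w ++ [(t, I0)]), cls A (w ++ [(t, I1)]), cls A (w ++ [(t, I2)])).

Lemma get_pt_of w t k : get (pt_of w t) k = cls A (w ++ [(t, k)]).
Proof. now destruct k. Qed.

Lemma edge_of_points w w' t s k : link A w t -> link A w' s ->
  (forall l, l <> k -> get (pt_of w t) l = get (pt_of w' s) l) -> get t k = get s k.
Proof.
  intros Hw Hw' H.
  assert (G : forall l, l <> k -> teq A (w ++ [(t, l)]) (w' ++ [(s, l)])).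
  { intros l Hl. specialize (H l Hl). rewrite !get_pt_of in H.
    apply cls_eq in H; auto; now apply link_trail. }
  destruct k.
  - apply (point_labels w w' t s I1 I2 I1 I2); auto; apply G; discriminate.
  - apply (point_labels w w' t s I0 I2 I0 I2); auto; apply G; discriminate.
  - apply (point_labels w w' t s I0 I1 I0 I1); auto; apply G; discriminate.
Qed.

Lemma Rt_disjoint t s v : Rt A t v -> Rt A s v -> t = s.
Proof.
  intros Ht Hs. apply Rt_elim in Ht, Hs. destruct Ht as [w [Hw ->]], Hs as [w' [Hw' E]].
  change (pt_of w t = pt_of w' s) in E.
  assert (G : forall k, get t k = get s k).
  { intros k. apply (edge_of_points w w'); auto. intros l _. now rewrite E. }
  destruct t as [[a b] c], s as [[a' b'] c'].
  specialize (G I0) as G0. specialize (G I1) as G1. specialize (G I2) as G2. simpl in *.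
  congruence.
Qed.

Lemma Rt_nonempty t : inB A t -> exists v, Rt A t v.
Proof. intros H. eexists. apply (Rt_intro A []). now apply trail_single. Qed.

Lemma Rt_inB t v : Rt A t v -> inB A t.
Proof. intros H. apply Rt_elim in H. destruct H as [w [H _]]. eauto using link_inB. Qed.

Lemma Rt_diag t v i j : Rt A t v -> (diag A i j v <-> inE A i j t).
Proof.
  intros H. pose proof (Rt_inU3 _ _ _ H) as HU. apply Rt_elim in H. destruct H as [w [Hw ->]].
  change (diag A i j (pt_of w t) <-> inE A i j t). unfold diag. rewrite !get_pt_of.
  rewrite cls_eq by now apply link_trail. rewrite point_eq_iff by auto. tauto.
Qed.

Lemma Rt_cyl t v k (X : Set3 A) : (forall u, X u -> Vset A u) -> Rt A t v ->
  (cyl A k X v <-> exists s, inT A k t s /\ exists u, X u /\ Rt A s u /\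
     forall l, l <> k -> get u l = get v l).
Proof.
  intros HX Hv. split.
  - intros [_ [u [Hu E]]]. destruct (HX u Hu) as [s [Hs Hus]]. exists s. split; [|eauto].
    split; [eauto using Rt_inB|]. split; auto.
    apply Rt_elim in Hv, Hus. destruct Hv as [w [Hw ->]], Hus as [w' [Hw' ->]].
    symmetry. now apply (edge_of_points w' w).
  - intros [s [_ [u [Hu [_ E]]]]]. split; eauto using Rt_inU3.
Qed.

Lemma Rt_extend t s v k : Rt A t v -> inT A k t s ->
  exists u, Rt A s u /\ forall l, l <> k -> get u l = get v l.
Proof.
  (* A trail may not repeat a triangle in consecutive nodes, so [t = s] is treated apart; otherwise
     one more step to [s] keeps the points of index other than [k]. *)
  intros Hv HT. destruct (classic (t = s)) as [<-|Hn]; [eauto|].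
  apply Rt_elim in Hv. destruct Hv as [w [Hw ->]].
  assert (Hws : link A (w ++ [(t, k)]) s) by now apply link_snoc.
  exists (pt_of (w ++ [(t, k)]) s). split; [now apply Rt_intro|].
  intros l Hl. change (get (pt_of (w ++ [(t, k)]) s) l = get (pt_of w t) l).
  rewrite !get_pt_of. apply cls_eq; try now apply link_trail.
  apply rst_step. split; [now apply link_trail|]. split; [now apply link_trail|].
  right; left. exists w, t, s, k, l. now rewrite <- app_assoc.
Qed.

End Points.

(** * Unions of the sets [Rt t] *)

Section Unions.
Variable A : WAsig.
Hypothesis HA : is_WA A.
Hypothesis Hat : is_atomic A.
Implicit Types (s t : Tri A) (S : Tri A -> Prop) (X : Set3 A).

Lemma set3_ext (X Y : Set3 A) : (forall v, X v <-> Y v) -> X = Y.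
Proof.
  intros H. apply functional_extensionality. intros v. now apply propositional_extensionality.
Qed.

Definition union_R S : Set3 A := fun v => exists t, S t /\ Rt A t v.

Lemma union_R_mem S t v : Rt A t v -> (union_R S v <-> S t).
Proof.
  intros Hv. split; [|now exists t]. intros [s [Hs Hv']].
  now rewrite (Rt_disjoint A HA Hat t s v).
Qed.

Lemma union_R_V S v : union_R S v -> Vset A v.
Proof. intros [t [_ Ht]]. exists t. eauto using Rt_inB. Qed.

Lemma union_R_eq S S' : union_R S = union_R S' <-> forall t, inB A t -> (S t <-> S' t).
Proof.
  split.
  - intros E t Ht. destruct (Rt_nonempty A t Ht) as [v Hv].
    rewrite <- (union_R_mem S t v), E by auto. now apply union_R_mem.
  - intros H. apply set3_ext. intros v.
    split; intros [t [H1 H2]]; exists t; split; auto; apply H; eauto using Rt_inB.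
Qed.

Lemma union_R_intro X S : (forall v, X v -> Vset A v) ->
  (forall t v, Rt A t v -> (X v <-> S t)) -> X = union_R S.
Proof.
  intros HV H. apply set3_ext. intros v. split.
  - intros Hv. destruct (HV v Hv) as [t [_ Ht]]. exists t. split; auto. now apply (H t v).
  - intros [t [Hs Ht]]. now apply (H t v).
Qed.

Lemma inRl_union_R S : inRl A (union_R S).
Proof.
  split; [|apply union_R_V].
  replace (union_R S) with (bigunion A (fun X => exists t, inB A t /\ S t /\ X = Rt A t)).
  - apply Cg_bigunion. intros X [t [Ht [_ ->]]]. now apply Cg_R.
  - apply set3_ext. intros v. split.
    + intros [X [[t [Ht [Hs ->]]] Hv]]. now exists t.
    + intros [t [Hs Hv]]. exists (Rt A t). split; auto. exists t. eauto using Rt_inB.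
Qed.

Lemma inRl_is_union X : inRl A X -> X = union_R (fun t => exists v, Rt A t v /\ X v).
Proof.
  intros [HX HV]. apply union_R_intro; auto. intros t v Hv. split; [eauto|].
  intros [u [Hu Hx]]. now apply (Cgen_Rt_homogeneous A X t u).
Qed.

Lemma rcyl_union_R k S : rcyl A k (union_R S) = union_R (fun t => exists s, inT A k t s /\ S s).
Proof.
  apply union_R_intro; [now intros v []|]. intros t v Hv. unfold rcyl.
  rewrite (Rt_cyl A HA Hat t v k _ (union_R_V S) Hv). split.
  - intros [_ [s [HT [u [Hu [Hsu _]]]]]]. exists s. split; auto. now apply (union_R_mem S s u).
  - intros [s [HT Hs]]. split; [exists t; eauto using Rt_inB|]. exists s. split; auto.
    destruct (Rt_extend A t s v k Hv HT) as [u [Hu E]]. exists u. split; auto. now exists s.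
Qed.

Lemma rdiag_union_R i j : rdiag A i j = union_R (inE A i j).
Proof.
  apply union_R_intro; [now intros v []|]. intros t v Hv. unfold rdiag.
  rewrite (Rt_diag A HA Hat t v i j Hv). split; [tauto|].
  split; auto. exists t. eauto using Rt_inB.
Qed.

Lemma sinter_union_R S S' : sinter A (union_R S) (union_R S') = union_R (fun t => S t /\ S' t).
Proof.
  apply union_R_intro.
  - intros v [H _]. now apply union_R_V in H.
  - intros t v Hv. unfold sinter. now rewrite !(union_R_mem _ t v Hv).
Qed.

Lemma sunion_union_R S S' : sunion A (union_R S) (union_R S') = union_R (fun t => S t \/ S' t).
Proof.
  apply union_R_intro.
  - intros v [H|H]; now apply union_R_V in H.
  - intros t v Hv. unfold sunion. now rewrite !(union_R_mem _ t v Hv).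
Qed.

Lemma rcompl_union_R S : rcompl A (union_R S) = union_R (fun t => ~ S t).
Proof.
  apply union_R_intro; [now intros v []|]. intros t v Hv. unfold rcompl.
  rewrite (union_R_mem _ t v Hv). split; [tauto|]. split; auto.
  exists t. eauto using Rt_inB.
Qed.

Lemma Rt_union_R t : Rt A t = union_R (fun s => s = t).
Proof.
  apply set3_ext. intros v. split; [now exists t|]. now intros [s [-> Hv]].
Qed.

(** * Atoms of the relativized algebra *)

Lemma Rl_atom_iff X : Rl_atom A X <-> exists t, inB A t /\ X = Rt A t.
Proof.
  split.
  - intros [HX [Hne Hmin]].
    assert (Hv : exists v, X v).
    { apply NNPP. intros Hn. apply Hne, set3_ext. intros v. split; [|easy].
      intros Hv. apply Hn. now exists v. }
    destruct Hv as [v Hv]. destruct (proj2 HX v Hv) as [t [Ht Htv]]. exists t. split; auto.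
    destruct (Hmin (Rt A t)) as [E|E]; auto.
    + rewrite Rt_union_R. apply inRl_union_R.
    + intros u Hu. apply (Cgen_Rt_homogeneous A X t v); auto. apply HX.
    + exfalso. rewrite E in Htv. exact Htv.
  - intros [t [Ht ->]]. destruct (Rt_nonempty A t Ht) as [v Hv]. split; [|split].
    + rewrite Rt_union_R. apply inRl_union_R.
    + intros E. rewrite E in Hv. exact Hv.
    + intros Y HY Hle. destruct (classic (exists u, Y u)) as [[u Hu]|Hn].
      * right. apply set3_ext. intros w. split; auto. intros Hw.
        apply (Cgen_Rt_homogeneous A Y t u w); auto. apply HY.
      * left. apply set3_ext. intros w. split; [|easy]. intros Hw. apply Hn. now exists w.
Qed.

(** * The isomorphism *)

Local Notation "x <= y" := (wle A x y).
Local Notation "x ;; y" := (wcomp A x y) (at level 40, left associativity).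
Local Notation "x ˘" := (wconv A x) (at level 1, format "x ˘").
Local Notation e := (wid A).
Local Notation atom := (is_atom A).
Implicit Types a b c : car A.

Lemma right_unit_atom c : atom c -> exists u, atom u /\ u <= e /\ c <= c ;; u.
Proof.
  intros Hc. apply comp_atom_r; auto. rewrite comp1 by auto. now apply le_refl.
Qed.

Lemma left_unit_atom c : atom c -> exists u, atom u /\ u <= e /\ c <= u ;; c.
Proof.
  intros Hc. apply comp_atom_l; auto. rewrite id_comp by auto. now apply le_refl.
Qed.

(** This and the next two degenerate triangles copy an atom from one edge to another, the third edge
    being an identity atom; they realize the substitutions in [ra_comp] and [ra_conv]. *)
Lemma triangle_E12 c : atom c -> exists t, inB A t /\ inE A I1 I2 t /\ get t I1 = c /\ get t I2 = c.
Proof.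
  intros Hc. destruct (right_unit_atom c Hc) as [u [Hu [Hue H]]].
  assert (Ht : inB A (u, c, c)) by (unfold inB; simpl; auto).
  exists (u, c, c). split; [|split]; auto. now apply inE_iff.
Qed.

Lemma triangle_E01 c : atom c -> exists t, inB A t /\ inE A I0 I1 t /\ get t I0 = c /\ get t I1 = c.
Proof.
  intros Hc. destruct (left_unit_atom c Hc) as [u [Hu [Hue H]]].
  assert (Ht : inB A (c, c, u)) by (unfold inB; simpl; auto).
  exists (c, c, u). split; [|split]; auto. now apply inE_iff.
Qed.

Lemma triangle_E02 c : atom c -> exists t, inB A t /\ inE A I0 I2 t /\ get t I0 = c /\ get t I2 = c˘.
Proof.
  intros Hc. destruct (right_unit_atom c Hc) as [u [Hu [Hue H]]].
  apply cycle_l in H; auto.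
  assert (Ht : inB A (c, u, c˘)).
  { unfold inB; simpl. auto using conv_atom. }
  exists (c, u, c˘). split; [|split]; auto. now apply inE_iff.
Qed.

Lemma inE12_edges t : inE A I1 I2 t -> get t I2 = get t I1.
Proof.
  intros H. assert (Ht : inB A t) by apply H. apply inE_iff in H; auto.
  apply (lab_replace A HA Hat t I0 I0 I1 I2); auto. now apply lab_diag_le.
Qed.

Lemma inE01_edges t : inE A I0 I1 t -> get t I1 = get t I0.
Proof.
  intros H. assert (Ht : inB A t) by apply H. apply inE_iff in H; auto.
  now apply (lab_replace_l A HA Hat t I0 I1 I2).
Qed.

Lemma inE02_edges t : inE A I0 I2 t -> get t I2 = (get t I0)˘.
Proof.
  intros H. assert (Ht : inB A t) by apply H. apply inE_iff in H; auto.
  now apply (lab_replace_l A HA Hat t I0 I2 I1).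
Qed.

Lemma inE_sym k l t : inE A k l t -> inE A l k t.
Proof. intros [Ht [->|[H1 H2]]]; split; auto. right. split; auto. now destruct k, l. Qed.

Lemma inB_atom t k : inB A t -> atom (get t k).
Proof. intros [H0 [H1 [H2 _]]]. now destruct k. Qed.

Lemma inT_intro k s t : inB A s -> inB A t -> get s k = get t k -> inT A k s t.
Proof. now split. Qed.

Definition to_Ra a : Set3 A := union_R (fun t => get t I2 <= a).

Lemma to_Ra_inRa a : inRa A (to_Ra a).
Proof.
  split; [apply inRl_union_R|]. unfold to_Ra. rewrite rcyl_union_R. apply union_R_eq.
  intros t Ht. split.
  - intros [s [[_ [_ E]] H]]. now rewrite E.
  - intros H. exists t. auto using inT_intro.
Qed.

(** Every atom is the edge from 0 to 1 of some triangle, so the image of [a] determines the atoms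
    below [a]. *)
Lemma to_Ra_inj a b : to_Ra a = to_Ra b -> a = b.
Proof.
  intros E. apply eq_from_atoms; auto. intros c Hc.
  destruct (triangle_E12 c Hc) as [t [Ht [_ [_ <-]]]].
  exact (proj1 (union_R_eq _ _) E t Ht).
Qed.

Lemma to_Ra_surj X : is_complete A -> inRa A X -> exists a, to_Ra a = X.
Proof.
  intros Hcomp [HX Hcyl]. apply inRl_is_union in HX.
  set (S := fun t => exists v, Rt A t v /\ X v) in HX. rewrite HX in Hcyl.
  rewrite rcyl_union_R, union_R_eq in Hcyl. rewrite HX. clearbody S. clear HX.
  (* The preimage is the supremum of the edges from 0 to 1 of the triangles in [S]. *)
  destruct (Hcomp (fun x => exists t, inB A t /\ S t /\ x = get t I2)) as [a [Hub Hlub]].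
  exists a. apply union_R_eq. intros t Ht. split.
  - intros Hle. apply NNPP. intros Hn.
    apply (atom_not_le_compl A HA (get t I2) (get t I2)); [now apply inB_atom|now apply le_refl|].
    (* If [get t I2] were none of these edges, its complement would bound them all, hence bound [a].
       Membership in [S] depends only on [get t I2], by closure under [T_2]. *)
    eapply le_trans; [exact HA|exact Hle|]. apply Hlub. intros x [s [Hs [HSs ->]]].
    apply atom_le_compl; auto using inB_atom. intros H. apply Hn.
    apply atom_le_atom in H; auto using inB_atom.
    apply Hcyl; auto. exists s. auto using inT_intro.
  - intros H. apply Hub. now exists t.
Qed.

Lemma to_Ra_plus a b : to_Ra (wplus A a b) = sunion A (to_Ra a) (to_Ra b).
Proof.
  unfold to_Ra. rewrite sunion_union_R. apply union_R_eq. intros t Ht. split.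
  - apply atom_le_plus; auto using inB_atom.
  - intros [H|H]; eapply le_trans; eauto using le_plus_l, le_plus_r.
Qed.

Lemma to_Ra_compl a : to_Ra (wcompl A a) = rcompl A (to_Ra a).
Proof.
  unfold to_Ra. rewrite rcompl_union_R. apply union_R_eq. intros t Ht. split.
  - intros H1 H2. apply (atom_not_le_compl A HA (get t I2) a); auto using inB_atom.
  - intros H. apply atom_le_compl; auto using inB_atom.
Qed.

Lemma to_Ra_comp a b : to_Ra (a ;; b) = ra_comp A (to_Ra a) (to_Ra b).
Proof.
  unfold to_Ra, ra_comp. rewrite !rdiag_union_R.
  repeat (rewrite sinter_union_R || rewrite rcyl_union_R).
  apply union_R_eq. intros t Ht. pose proof (inB_atom t I2 Ht) as Ha. split.
  - intros H. apply comp_atom_l in H; auto. destruct H as [x [Hx [Hxa H]]].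
    apply comp_atom_r in H; auto. destruct H as [y [Hy [Hyb H]]].
    assert (Hy' : atom y˘) by now apply conv_atom.
    (* Vertex 2 serves as the intermediate point: [x] leads from 0 to 2 and [y] from 2 to 1. Then
       [q] copies [x], and [r] copies [y], to the edge from 0 to 1. *)
    assert (Hs : inB A (y˘, x, get t I2)).
    { unfold inB. simpl. auto using cycle_r. }
    exists (y˘, x, get t I2). split; [now apply inT_intro|].
    destruct (triangle_E12 x Hx) as [q [Hq [HE [E1 E2]]]].
    destruct (triangle_E02 y˘ Hy') as [r [Hr [HE' [E0 E2']]]].
    rewrite convK in E2' by auto. split.
    + exists q. split; [now apply inT_intro|]. rewrite E2. auto.
    + exists r. split; [now apply inT_intro|]. rewrite E2'. auto.
  - intros [s [[_ [Hs E]] [[q [[_ [_ E1]] [HE Hqa]]] [r [[_ [_ E0]] [HE' Hrb]]]]]].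
    rewrite E. eapply le_trans; [exact HA|apply (lab_tri A HA s I0 I2 I1); easy|].
    simpl. apply comp_le; auto.
    + simpl in E1. rewrite E1. apply inE12_edges in HE. simpl in HE. now rewrite <- HE.
    + simpl in E0. rewrite E0. apply inE02_edges in HE'. simpl in HE'. now rewrite <- HE'.
Qed.

(** Three degenerate triangles carry the label from edge 2 to edge 0, then to 1, then back to 2;
    only the first, which identifies 0 and 2, reverses it. *)
Lemma to_Ra_conv a : to_Ra a˘ = ra_conv A (to_Ra a).
Proof.
  unfold to_Ra, ra_conv. rewrite !rdiag_union_R.
  repeat (rewrite sinter_union_R || rewrite rcyl_union_R).
  apply union_R_eq. intros t Ht. pose proof (inB_atom t I2 Ht) as Ha. split.
  - intros H. assert (Hc : atom (get t I2)˘) by now apply conv_atom.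
    destruct (triangle_E02 _ Hc) as [s [Hs [HE [E0 E2]]]]. rewrite convK in E2 by auto.
    destruct (triangle_E01 _ Hc) as [q [Hq [HE' [E0' E1']]]].
    destruct (triangle_E12 _ Hc) as [r [Hr [HE'' [E1'' E2'']]]].
    exists s. split; [now apply inT_intro|]. split; [now apply inE_sym|].
    exists q. split; [apply inT_intro; auto; congruence|]. split; auto.
    exists r. split; [apply inT_intro; auto; congruence|]. split; auto.
    rewrite E2''. now apply conv_le_iff.
  - intros [s [[_ [Hs E]] [HE [q [[_ [_ E0]] [HE' [r [[_ [_ E1]] [HE'' H]]]]]]]]].
    apply inE_sym, inE02_edges in HE. apply inE01_edges in HE'. apply inE12_edges in HE''.
    rewrite E, HE, E0, <- HE', E1, <- HE''. now apply conv_le.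
Qed.

Lemma to_Ra_id : to_Ra e = ra_id A.
Proof.
  unfold to_Ra, ra_id. rewrite rdiag_union_R. apply union_R_eq. intros t Ht.
  symmetry. now apply (inE_iff A HA t I0 I1).
Qed.

End Unions.

Theorem theorem6 (A : WAsig) :
  is_WA A -> is_complete A -> is_atomic A ->
  iso_to_Ra A /\
  (forall X : Set3 A, Rl_atom A X <-> exists t, inB A t /\ X = Rt A t).
Proof.
  intros HA Hcomp Hat. split; [|now apply Rl_atom_iff].
  exists (to_Ra A). repeat apply conj.
  - now apply to_Ra_inRa.
  - now apply to_Ra_inj.
  - intros X. now apply to_Ra_surj.
  - now apply to_Ra_plus.
  - now apply to_Ra_compl.
  - now apply to_Ra_comp.
  - now apply to_Ra_conv.
  - now apply to_Ra_id.
Qed.
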